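(* There is a non-atomic left-c.e. semi-measure $\rho$ such that every $X\in2^\omega$ belongs to $\mathsf{MLR}_\rho$.
   Context: $2^{<\omega}$ is the set of finite binary strings, $\varepsilon$ the empty string, $X{\upharpoonright}n$ the first $n$ bits of $X$, $[\![\sigma]\!]=\{X\in2^\omega:\sigma\preceq X\}$, $[\![S]\!]=\bigcup_{\sigma\in S}[\![\sigma]\!]$. A semi-measure is $\rho:2^{<\omega}\to[0,1]$ with $\rho(\varepsilon)=1$ and $\rho(\sigma)\ge\rho(\sigma0)+\rho(\sigma1)$; it is left-c.e. if its values are uniformly approximable from below by a computable, non-decreasing sequence of rationals. Non-atomic means that no $X\in2^\omega$ is an atom, i.e., $\inf_n\rho(X{\upharpoonright}n)=0$ for every $X$. For $E\subseteq2^{<\omega}$, $\rho(E)=\sum_{\sigma\in E}\rho(\sigma)$; $X\in\mathsf{MLR}_\rho$ iff $X\notin\bigcap_i[\![U_i]\!]$ for every uniformly c.e. sequence $(U_i)$ of subsets of $2^{<\omega}$ with $\rho(U_i)\le2^{-i}$ for all $i$. *)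

(* Defs.v *)
From HB Require Import structures.
From mathcomp Require Import all_boot all_order all_algebra.
From mathcomp Require Import all_classical all_reals.
From mathcomp Require Import ereal esum.
From mathcomp Require Import Rstruct.
From Stdlib Require Import Reals.

Set Implicit Arguments. Unset Strict Implicit. Unset Printing Implicit Defensive.
Import Order.TTheory GRing.Theory Num.Theory.

(* Arguments are passed as a list; missing arguments default to 0.      *)
Inductive rf : Type :=
| RZero : rf
| RSucc : rf
| RProj : nat -> rf
| RComp : rf -> list rf -> rf
| RPrec : rf -> rf -> rf
| RMin  : rf -> rf.

Inductive eval : rf -> list nat -> nat -> Prop :=
| ev_zero xs : eval RZero xs 0
| ev_succ xs : eval RSucc xs (S (nth 0 xs 0))
| ev_proj i xs : eval (RProj i) xs (nth 0 xs i)
| ev_comp f gs xs ys y :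
    evals gs xs ys -> eval f ys y -> eval (RComp f gs) xs y
| ev_prec0 f g xs y : eval f xs y -> eval (RPrec f g) (0 :: xs) y
| ev_precS f g n xs y z :
    eval (RPrec f g) (n :: xs) y -> eval g (n :: y :: xs) z ->
    eval (RPrec f g) (S n :: xs) z
| ev_min f xs n :
    eval f (n :: xs) 0 ->
    (forall m, (m < n)%N -> exists k, eval f (m :: xs) (S k)) ->
    eval (RMin f) xs n
with evals : list rf -> list nat -> list nat -> Prop :=
| evs_nil xs : evals nil xs nil
| evs_cons g gs xs y ys :
    eval g xs y -> evals gs xs ys -> evals (g :: gs) xs (y :: ys).

(* Coding of finite binary strings by natural numbers (bijective base 2). *)
Fixpoint code (s : seq bool) : nat :=
  match s with
  | [::] => 0
  | b :: s' => ((code s').*2 + 1 + b)%N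
  end.

Definition computable_sn (f : seq bool -> nat -> nat) : Prop :=
  exists e : rf, forall (s : seq bool) (n : nat), eval e [:: code s; n] (f s n).

Definition unif_ce (U : nat -> set (seq bool)) : Prop :=
  exists e : rf, forall (i : nat) (s : seq bool),
    U i s <-> exists y, eval e [:: i; code s] y.

Local Open Scope ring_scope.

Definition semimeasure (rho : seq bool -> R) : Prop :=
  (forall s, 0 <= rho s <= 1) /\ rho [::] = 1 /\
  (forall s, rho (rcons s false) + rho (rcons s true) <= rho s).

(* Left-c.e.: rho s = lim_t q s t, q non-decreasing in t, q computable rationals,
   where the rational q s t is coded as (a s t - b s t) / (c s t + 1). *)
Definition left_ce (rho : seq bool -> R) : Prop :=
  exists a b c : seq bool -> nat -> nat,
    [/\ computable_sn a, computable_sn b, computable_sn c &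
    let q := fun s t => ((a s t)%:R - (b s t)%:R) / ((c s t).+1)%:R : R in
    forall s,
      (forall t, q s t <= q s t.+1) /\ (forall t, q s t <= rho s) /\
      (forall eps : R, 0 < eps -> exists t, rho s - eps < q s t)].

Definition restr (X : nat -> bool) (n : nat) : seq bool := mkseq X n.

(* Non-atomic: inf_n rho (X|n) = 0 for every X (values are >= 0). *)
Definition non_atomic (rho : seq bool -> R) : Prop :=
  forall X : nat -> bool, forall eps : R, 0 < eps -> exists n, rho (restr X n) < eps.

Definition in_cyl (U : set (seq bool)) (X : nat -> bool) : Prop :=
  exists2 s, U s & s = restr X (size s).

Definition rho_set (rho : seq bool -> R) (U : set (seq bool)) : \bar R :=
  (\esum_(s in U) (rho s)%:E)%E.

Definition MLR (rho : seq bool -> R) (X : nat -> bool) : Prop :=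
  forall U : nat -> set (seq bool), unif_ce U ->
    (forall i, (rho_set rho (U i) <= ((2 ^- i : R))%:E)%E) ->
    ~ (forall i, in_cyl (U i) X).

(* Main.v *)
Require Import Defs.
From mathcomp Require Import all_boot all_algebra all_classical all_reals ereal Rstruct.
From mathcomp Require Import all_order esum zify lra.
(* [all_classical] and its dependencies shadow [eval]. *)
Import Defs.

(* A semi-measure may lose mass, so requirement [e], attached to the [e]-th
   program, can spend 2^-(e+1) on a single string.  Wait until program [e]
   enumerates some string sigma into its set of level [e+2], and then add
   2^-(e+1) to the measure of all prefixes of the first such sigma.  If [e]
   enumerates a test, this makes the measure of that level exceed 2^-(e+2),
   unless the level stays empty and so covers nothing.  The weights sum to at
   most 1 and each requirement charges a finite chain of strings only, so
   there are no atoms.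

   The enumeration of all programs needs a universal machine: it is a stack of
   goals "program, arguments, value", each step replacing the top goal by its
   premises under one evaluation rule, with guessed intermediate values; all
   this is coded by numbers, so that the step function is recursive. *)

Set Implicit Arguments. Unset Strict Implicit. Unset Printing Implicit Defensive.
Import Order.TTheory GRing.Theory Num.Theory.

(** * Closure properties of recursive functions of fixed arity *)

Definition recf (k : nat) (F : seq nat -> nat) : Prop :=
  exists e, forall xs, size xs = k -> eval e xs (F xs).

Lemma recf_ext k F G : F =1 G -> recf k F -> recf k G.
Proof. by move=> FG [e He]; exists e => xs /He; rewrite FG. Qed.

Lemma recf_proj k i : recf k (fun xs => nth 0 xs i).
Proof. by exists (RProj i) => xs _; constructor. Qed.

Lemma recf_app1 k f A : recf 1 (fun v => f (nth 0 v 0)) -> recf k A ->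
  recf k (fun xs => f (A xs)).
Proof.
move=> [e He] [a Ha]; exists (RComp e [:: a]) => xs hxs.
apply: (ev_comp (ys := [:: A xs])); last exact: (He [:: A xs]).
by constructor; [exact: Ha | constructor].
Qed.

Lemma recf_app2 k f A B : recf 2 (fun v => f (nth 0 v 0) (nth 0 v 1)) ->
  recf k A -> recf k B -> recf k (fun xs => f (A xs) (B xs)).
Proof.
move=> [e He] [a Ha] [b Hb]; exists (RComp e [:: a; b]) => xs hxs.
apply: (ev_comp (ys := [:: A xs; B xs])); last exact: (He [:: A xs; B xs]).
by do !(constructor; [by auto|]); constructor.
Qed.

Lemma recf_app3 k f A B C :
  recf 3 (fun v => f (nth 0 v 0) (nth 0 v 1) (nth 0 v 2)) ->
  recf k A -> recf k B -> recf k C -> recf k (fun xs => f (A xs) (B xs) (C xs)).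
Proof.
move=> [e He] [a Ha] [b Hb] [c Hc]; exists (RComp e [:: a; b; c]) => xs hxs.
apply: (ev_comp (ys := [:: A xs; B xs; C xs])); last exact: (He [:: _; _; _]).
by do !(constructor; [by auto|]); constructor.
Qed.

Lemma evals_proj xs : evals [seq RProj i | i <- iota 0 (size xs)] xs xs.
Proof.
suff H ys zs : xs = ys ++ zs ->
    evals [seq RProj i | i <- iota (size ys) (size zs)] xs zs by exact: (H [::]).
elim: zs ys => [|z zs IH] ys E; first by constructor.
constructor.
  have -> : z = nth 0 xs (size ys) by rewrite E nth_cat ltnn subnn.
  exact: ev_proj.
by rewrite -(size_rcons ys z); apply: IH; rewrite cat_rcons.
Qed.

(** [RPrec] recurses on the head of its argument list, so the [k] arguments are copied behind the
    counter by [k] projections; this is why [recf] fixes the length of its lists. *)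
Lemma recf_iteri k G A N : recf k.+2 G -> recf k A -> recf k N ->
  recf k (fun xs => iteri (N xs) (fun n y => G [:: n, y & xs]) (A xs)).
Proof.
move=> [g Hg] [a Ha] [n Hn].
exists (RComp (RPrec a g) (n :: [seq RProj i | i <- iota 0 k])) => xs hxs.
apply: (ev_comp (ys := N xs :: xs)).
  by constructor; [exact: Hn | rewrite -hxs; exact: evals_proj].
elim: (N xs) => [|m IH]; first by constructor; exact: Ha.
by apply: ev_precS IH _; apply: Hg; rewrite /= hxs.
Qed.

Lemma recf_const k c : recf k (fun=> c).
Proof.
elim: c => [|c [e He]]; first by exists RZero => xs _; constructor.
exists (RComp RSucc [:: e]) => xs /He h.
apply: ev_comp; first by constructor; [exact: h | constructor].
exact: (ev_succ [:: c]).
Qed.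

Lemma recf_succ k A : recf k A -> recf k (fun xs => (A xs).+1).
Proof.
move=> [e He]; exists (RComp RSucc [:: e]) => xs /He h.
apply: ev_comp; first by constructor; [exact: h | constructor].
exact: (ev_succ [:: _]).
Qed.

Lemma recf_pred k A : recf k A -> recf k (fun xs => (A xs).-1).
Proof.
apply: (recf_app1 (f := predn)).
apply: (recf_ext _ (recf_iteri (recf_proj _ 0) (recf_const _ 0) (recf_proj _ 0))).
by move=> xs /=; case: (nth _ _ _).
Qed.

Lemma recf_add k A B : recf k A -> recf k B -> recf k (fun xs => A xs + B xs).
Proof.
move=> hA hB.
apply: (recf_ext _ (recf_iteri (recf_succ (recf_proj _ 1)) hB hA)) => xs /=.
by elim: (A xs) => //= n ->.
Qed.

Lemma recf_mul k A B : recf k A -> recf k B -> recf k (fun xs => A xs * B xs).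
Proof.
apply: (recf_app2 (f := muln)).
apply: (recf_ext _ (recf_iteri (recf_add (recf_proj _ 3) (recf_proj _ 1))
  (recf_const _ 0) (recf_proj _ 0))) => xs /=.
by elim: (nth 0 xs 0) => //= n ->; rewrite mulSn.
Qed.

Lemma recf_sub k A B : recf k A -> recf k B -> recf k (fun xs => A xs - B xs).
Proof.
move=> hA hB.
apply: (recf_ext _ (recf_iteri (recf_pred (recf_proj _ 1)) hA hB)) => xs /=.
by elim: (B xs) => [|n IH] /=; rewrite ?subn0 // IH subnS.
Qed.

Lemma recf_exp2 k A : recf k A -> recf k (fun xs => 2 ^ A xs).
Proof.
move=> hA.
apply: (recf_ext _ (recf_iteri (recf_mul (recf_const _ 2) (recf_proj _ 1))
  (recf_const _ 1) hA)) => xs /=.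
by elim: (A xs) => //= n ->; rewrite expnS.
Qed.

Lemma recf_if0 k A B C : recf k A -> recf k B -> recf k C ->
  recf k (fun xs => if A xs == 0 then B xs else C xs).
Proof.
apply: (recf_app3 (f := fun a b c => if a == 0 then b else c)).
(* Iterating [a] times a step that always returns [c], starting from [b], leaves [b] exactly when
   [a = 0]. *)
apply: (recf_ext _ (recf_iteri (recf_proj _ 4) (recf_proj _ 1) (recf_proj _ 0))).
by move=> xs /=; case: (nth 0 xs 0).
Qed.

Lemma recf_ifle k A B C D : recf k A -> recf k B -> recf k C -> recf k D ->
  recf k (fun xs => if A xs <= B xs then C xs else D xs).
Proof. by move=> hA hB; apply: recf_if0; exact: recf_sub. Qed.

Lemma recf_ifeq k A B C D : recf k A -> recf k B -> recf k C -> recf k D ->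
  recf k (fun xs => if A xs == B xs then C xs else D xs).
Proof.
move=> hA hB hC hD.
apply: (recf_ext _ (recf_if0 (recf_add (recf_sub hA hB) (recf_sub hB hA)) hC hD)).
by move=> xs; rewrite addn_eq0 !subn_eq0 -eqn_leq.
Qed.

(** * Pairing and coded lists by integer square roots *)

Definition floor_inv (f : nat -> nat) n :=
  iteri n (fun m r => if f r.+1 <= m.+1 then r.+1 else r) 0.

(** Because [f] grows by at least one per step, raising [n] by one raises the largest [r] with
    [f r <= n] by at most one, so one test per iteration is enough. *)
Lemma floor_inv_eq f n r : f 0 = 0 -> (forall i, f i < f i.+1) ->
  f r <= n < f r.+1 -> floor_inv f n = r.
Proof.
move=> f0 fS; have fmono := leqW_mono (leq_mono (homo_ltn ltn_trans fS)).
have invP : f (floor_inv f n) <= n < f (floor_inv f n).+1.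
  elim: n => [|n /andP[h1 h2]]; first by rewrite /= f0 /= -{1}f0.
  rewrite /floor_inv /= -/(floor_inv f n); case: ifP => [h|/negbT].
    by rewrite h /=; apply: leq_ltn_trans (fS _).
  by rewrite -ltnNge => ->; rewrite (leq_trans h1).
case/andP: invP => h1 h2 /andP[h3 h4]; apply/eqP; rewrite eqn_leq.
have := leq_ltn_trans h1 h4; have := leq_ltn_trans h3 h2.
by rewrite !fmono !ltnS => -> ->.
Qed.

Lemma recf_floor_inv f k A : recf 1 (fun v => f (nth 0 v 0)) -> recf k A ->
  recf k (fun xs => floor_inv f (A xs)).
Proof.
move=> hf hA; pose G v := if f (nth 0 v 1).+1 <= (nth 0 v 0).+1
  then (nth 0 v 1).+1 else nth 0 v 1.
apply: (recf_iteri (G := G) _ (recf_const _ 0) hA).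
apply: recf_ifle; do ?[exact: recf_proj | apply: recf_succ].
by apply: recf_app1 hf _; apply: recf_succ; exact: recf_proj.
Qed.

(** The value lies between the squares of [a + b] and [a + b + 1], so an integer square root
    recovers [a + b], and the remainder is [a]. *)
Definition npair a b := (a + b) * (a + b) + a.
Definition isqrt n := floor_inv (fun r => r * r) n.
Definition nfst n := n - isqrt n * isqrt n.
Definition nsnd n := isqrt n - nfst n.

Lemma isqrt_npair a b : isqrt (npair a b) = a + b.
Proof. by apply: floor_inv_eq => // [i|]; rewrite /npair; nia. Qed.

Lemma nfst_npair a b : nfst (npair a b) = a.
Proof. by rewrite /nfst isqrt_npair /npair addKn. Qed.

Lemma nsnd_npair a b : nsnd (npair a b) = b.
Proof. by rewrite /nsnd isqrt_npair nfst_npair addKn. Qed.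

Lemma recf_npair k A B : recf k A -> recf k B ->
  recf k (fun xs => npair (A xs) (B xs)).
Proof. by move=> hA hB; do ![apply: recf_add | apply: recf_mul]. Qed.

Lemma recf_isqrt k A : recf k A -> recf k (fun xs => isqrt (A xs)).
Proof. by apply: recf_floor_inv; apply: recf_mul; exact: recf_proj. Qed.

Lemma recf_nfst k A : recf k A -> recf k (fun xs => nfst (A xs)).
Proof. by move=> hA; do ?[apply: recf_sub | apply: recf_mul | apply: recf_isqrt]. Qed.

Lemma recf_nsnd k A : recf k A -> recf k (fun xs => nsnd (A xs)).
Proof. by move=> hA; apply: recf_sub; [exact: recf_isqrt | exact: recf_nfst]. Qed.

(** The successor keeps 0 for the empty list. Head and tail of 0 are again 0, in agreement with the
    default value of missing arguments. *)
Definition ncons a l := (npair a l).+1.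
Definition nhd l := nfst l.-1.
Definition ntl l := nsnd l.-1.
Definition encl (xs : seq nat) := foldr ncons 0 xs.

Lemma nhd_ncons a l : nhd (ncons a l) = a. Proof. exact: nfst_npair. Qed.
Lemma ntl_ncons a l : ntl (ncons a l) = l. Proof. exact: nsnd_npair. Qed.
Lemma nfst0 : nfst 0 = 0. Proof. by []. Qed.
Lemma nsnd0 : nsnd 0 = 0. Proof. by []. Qed.
Definition npairE := (nfst0, nsnd0, nfst_npair, nsnd_npair, nhd_ncons, ntl_ncons).

Opaque npair nfst nsnd.

Lemma nhd_encl xs : nhd (encl xs) = nth 0 xs 0.
Proof. by case: xs => [|x xs]; rewrite ?nhd_ncons // /nhd nfst0. Qed.

Lemma ntl_encl xs : ntl (encl xs) = encl (behead xs).
Proof. by case: xs => [|x xs]; rewrite ?ntl_ncons // /ntl nsnd0. Qed.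

(** * A universal machine on stacks of goals *)

Fixpoint enc (e : rf) : nat :=
  match e with
  | RZero => npair 0 0
  | RSucc => npair 1 0
  | RProj i => npair 2 i
  | RComp f gs =>
      npair 3 (npair (enc f) (foldr (fun g l => npair 7 (npair (enc g) l)) 0 gs))
  | RPrec f g => npair 4 (npair (enc f) (enc g))
  | RMin f => npair 5 (enc f)
  end.

Definition goal e x y := npair e (npair x y).

(* [z] is a guessed intermediate value, [T] the goals below the top one and
   [G] the whole stack, returned when the top goal cannot be met.  Besides the
   tags of [enc], 0 and 7 are nil and cons for lists of programs, and 6 asserts
   that a program has positive values at all arguments below [y]. *)
Definition expand z e x y T G :=
  let t := nfst e in let d := nsnd e in
  if t == 0 then if y == 0 then T else G else
  if t == 1 then if y == (nhd x).+1 then T else G else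
  if t == 2 then
    if d == 0 then if y == nhd x then T else G
    else ncons (goal (npair 2 d.-1) (ntl x) y) T else
  if t == 3 then
    ncons (goal (nsnd d) x z) (ncons (goal (nfst d) z y) T) else
  if t == 4 then
    if x == 0 then G else
    if nhd x == 0 then ncons (goal (nfst d) (ntl x) y) T
    else ncons (goal e (ncons (nhd x).-1 (ntl x)) z)
      (ncons (goal (nsnd d) (ncons (nhd x).-1 (ncons z (ntl x))) y) T) else
  if t == 5 then
    ncons (goal d (ncons y x) 0) (ncons (goal (npair 6 d) x y) T) else
  if t == 6 then
    if y == 0 then T
    else ncons (goal d (ncons y.-1 x) z.+1)
      (ncons (goal (npair 6 d) x y.-1) T) else
  if y == 0 then G
  else ncons (goal (nfst d) x (nhd y)) (ncons (goal (nsnd d) x (ntl y)) T).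

(** A state pairs a stream of guesses, read by [nfst] and [nsnd], with the stack. Every step
    consumes one guess, whether or not the rule needs it. *)
Definition step s :=
  let G := nsnd s in let g := nhd G in
  npair (nsnd (nfst s))
    (expand (nfst (nfst s)) (nfst g) (nfst (nsnd g)) (nsnd (nsnd g)) (ntl G) G).

(** * Soundness of the machine *)

Inductive prog := PE of rf | PL of seq rf | PP of rf.

(** [PE RZero] and [PL [::]] share the code 0, which is harmless: either goal is met by the value 0
    only. *)
Definition encp p := match p with
  | PE e => enc e
  | PL gs => foldr (fun g l => npair 7 (npair (enc g) l)) 0 gs
  | PP f => npair 6 (enc f)
  end.

Definition encg (g : prog * nat * nat) := goal (encp g.1.1) g.1.2 g.2.
Definition state c gl := npair c (encl (map encg gl)).

(* Pairing is not onto, so a guessed list may fail to be of the form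
   [encl xs] even though all its items can be read off. *)
Fixpoint lists x (xs : seq nat) : Prop :=
  if xs is a :: xs' then [/\ x != 0, nhd x = a & lists (ntl x) xs'] else x = 0.

Lemma lists_nhd x xs : lists x xs -> nhd x = nth 0 xs 0.
Proof. by case: xs => [->|a xs []]. Qed.

Lemma lists_ntl x xs : lists x xs -> lists (ntl x) (behead xs).
Proof. by case: xs => [->|a xs []]. Qed.

Lemma lists_ncons a x xs : lists x xs -> lists (ncons a x) (a :: xs).
Proof. by split; rewrite ?npairE. Qed.

Lemma lists_encl xs : lists (encl xs) xs.
Proof. by elim: xs => // a xs; exact: lists_ncons. Qed.

(** Argument codes are read universally and result codes existentially. Thus in a composition the
    list [ys] obtained from [PL gs] for the guess [z] can be fed to the goal for [f] at [z]. *)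
Definition hold (g : prog * nat * nat) := forall xs, lists g.1.2 xs ->
  match g.1.1 with
  | PE e => eval e xs g.2
  | PL gs => exists2 ys, lists g.2 ys & evals gs xs ys
  | PP f => forall m, m < g.2 -> exists k, eval f (m :: xs) k.+1
  end.

Fixpoint holds gl := if gl is g :: gl' then hold g /\ holds gl' else True.

Lemma step_state c p x y gl :
  step (state c ((p, x, y) :: gl)) = npair (nsnd c)
    (expand (nfst c) (encp p) x y (encl (map encg gl))
       (encl (map encg ((p, x, y) :: gl)))).
Proof. by rewrite /step /state /= /encg /goal !npairE. Qed.

(** Each replacement is an instance of an evaluation rule read backwards, whatever the guess, so
    truth of the new goals gives truth of the old ones; a goal that cannot be met stays on the
    stack. *)
Lemma step_sound c gl : exists gl',
  step (state c gl) = state (nsnd c) gl' /\ (holds gl' -> holds gl).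
Proof.
case: gl => [|[[p x] y] gl].
  by exists [::]; rewrite /step /state /= !npairE.
set g := (p, x, y).
have self G : G = encl (map encg (g :: gl)) -> exists gl',
  npair (nsnd c) G = state (nsnd c) gl' /\ (holds gl' -> holds (g :: gl)).
  by move=> ->; exists (g :: gl).
rewrite step_state; move: (nfst c) => z; rewrite {}/g in self *.
case: p self => [[||i|f gs|f g|f]|gs|f] self;
  rewrite /expand /= ?npairE /=.
- case: eqP => [->|_]; last exact: self.
  by exists gl; split=> // h; split=> // xs _; constructor.
- case: eqP => [->|_]; last exact: self.
  exists gl; split=> // h; split=> // xs /= /lists_nhd->; exact: ev_succ.
- case: i self => [|i] self /=.
    case: eqP => [->|_]; last exact: self.
    exists gl; split=> // h; split=> // xs /= /lists_nhd->; exact: ev_proj.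
  exists ((PE (RProj i), ntl x, y) :: gl); split=> // -[h1 h]; split=> // xs /= E.
  have H := h1 (behead xs) (lists_ntl E).
  have -> : y = nth 0 xs i.+1 by rewrite -nth_behead; inversion H.
  exact: ev_proj.
- exists [:: (PL gs, x, z), (PE f, z, y) & gl]; split=> // -[h1 [h2 h]].
  split=> // xs /= /h1[ys /= E hys]; apply: ev_comp hys _; exact: h2.
- case: eqP => [_|x0]; first exact: self.
  case: eqP => [E0|/eqP E0].
    exists ((PE f, ntl x, y) :: gl); split=> // -[h1 h]; split=> // -[|a xs] //= E.
    case: E => _; rewrite E0 => <- E; apply: ev_prec0; exact: h1.
  exists [:: (PE (RPrec f g), ncons (nhd x).-1 (ntl x), z),
     (PE g, ncons (nhd x).-1 (ncons z (ntl x)), y) & gl].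
  split=> // -[h1 [h2 h]]; split=> // -[|a xs] //= [_ Ea E].
  rewrite Ea in h1 h2 E0; case: a E0 Ea h1 h2 => // n _ _ h1 h2.
  apply: ev_precS; [apply: h1 | apply: h2]; do !apply: lists_ncons; exact: E.
- exists [:: (PE f, ncons y x, 0), (PP f, x, y) & gl].
  split=> // -[h1 [h2 h]]; split=> // xs /= E; constructor; last exact: h2.
  by apply: h1; exact: lists_ncons.
- case: gs self => [|g gs] self /=; rewrite ?npairE /=; case: eqP => [y0|/eqP y0].
  + rewrite y0; exists gl; split=> // h; split=> // xs /= E.
    by exists [::] => //; constructor.
  + exact: self.
  + exact: self.
  exists [:: (PE g, x, nhd y), (PL gs, x, ntl y) & gl].
  split=> // -[h1 [h2 h]]; split=> // xs /= E.
  have [ys hy hys] := h2 xs E; exists (nhd y :: ys) => //.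
  by constructor=> //; exact: h1.
- case: eqP => [->|/eqP y0]; first by exists gl; split.
  exists [:: (PE f, ncons y.-1 x, z.+1), (PP f, x, y.-1) & gl].
  split=> // -[h1 [h2 h]]; split=> // xs /= E m.
  rewrite -(prednK (n := y)) ?lt0n // ltnS leq_eqVlt => /orP[/eqP->|].
    by exists z; apply: h1; exact: lists_ncons.
  exact: h2.
Qed.

Lemma run_sound n c gl : nsnd (iter n step (state c gl)) = 0 -> holds gl.
Proof.
elim: n c gl => [|n IH] c gl.
  by rewrite /= nsnd_npair; case: gl.
by rewrite iterSr; have [gl' [-> h]] := step_sound c gl => /IH.
Qed.

(** * Completeness of the machine *)

Definition reaches s s' := exists n, iter n step s = s'.

Lemma reaches_trans s2 s1 s3 : reaches s1 s2 -> reaches s2 s3 -> reaches s1 s3.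
Proof. by move=> [n <-] [m <-]; exists (m + n); rewrite iterD. Qed.

Lemma reaches_step s s' : reaches (step s) s' -> reaches s s'.
Proof. by move=> [n <-]; exists n.+1; rewrite iterSr. Qed.

(** The remaining guesses [c] and goals [gl] are arbitrary so that runs can be chained: the guess
    stream is built backwards, from the last premise to the first. *)
Definition provable p xs y := forall c gl, exists c',
  reaches (state c' ((p, encl xs, y) :: gl)) (state c gl).

Lemma provable_step z p xs y :
  (forall c gl, exists c',
     reaches (npair c' (expand z (encp p) (encl xs) y (encl (map encg gl))
       (encl (map encg ((p, encl xs, y) :: gl))))) (state c gl)) ->
  provable p xs y.
Proof.
move=> h c gl; have [c' hc] := h c gl; exists (npair z c').
by apply: reaches_step; rewrite step_state !npairE.
Qed.

Lemma reaches_refl s : reaches s s. Proof. by exists 0. Qed.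

(** The derivation dictates the guesses: the coded list of intermediate values for a composition,
    the previous value for a recursion, and 0 where none is read. *)
Lemma eval_provable e xs y : eval e xs y -> provable (PE e) xs y
with evals_provable gs xs ys : evals gs xs ys -> provable (PL gs) xs (encl ys).
Proof.
  case=> {e xs y} [xs|xs|i xs|f gs xs ys y hgs hf|f g xs y hf|
    f g n xs y z hf hg|f xs n hf hm].
  - apply: (@provable_step 0) => c gl; exists c.
    rewrite /expand /= ?npairE; exact: reaches_refl.
  - apply: (@provable_step 0) => c gl; exists c.
    rewrite /expand /= ?npairE /= nhd_encl eqxx; exact: reaches_refl.
  - elim: i xs => [|i IH] xs; apply: (@provable_step 0) => c gl.
      exists c; rewrite /expand /= ?npairE /= nhd_encl eqxx; exact: reaches_refl.
    have [c' h] := IH (behead xs) c gl; exists c'.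
    by move: h; rewrite /expand /= ?npairE /= ntl_encl nth_behead.
  - apply: (@provable_step (encl ys)) => c gl.
    have [c1 h1] := eval_provable _ _ _ hf c gl.
    have [c2 h2] := evals_provable _ _ _ hgs c1 ((PE f, encl ys, y) :: gl).
    by exists c2; apply: reaches_trans h1; move: h2; rewrite /expand /= ?npairE.
  - apply: (@provable_step 0) => c gl.
    have [c1 h1] := eval_provable _ _ _ hf c gl; exists c1.
    by move: h1; rewrite /expand /= ?npairE.
  - apply: (@provable_step y) => c gl.
    have [c1 h1] := eval_provable _ _ _ hg c gl.
    have [c2 h2] := eval_provable _ _ _ hf c1 ((PE g, encl (n :: y :: xs), z) :: gl).
    by exists c2; apply: reaches_trans h1; move: h2; rewrite /expand /= ?npairE.
  (* The recursive calls for the arguments below [n] are made first; an induction on [n] then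
     assembles them into the positivity goal. *)
  have hP : provable (PP f) xs n.
    have: forall m, m < n -> exists k, provable (PE f) (m :: xs) k.+1.
      by move=> m /hm[k h]; exists k; exact: eval_provable h.
    elim: n {hf hm} => [|n IH] hm.
      apply: (@provable_step 0) => c gl; exists c.
      rewrite /expand /= ?npairE; exact: reaches_refl.
    have [k hk] := hm n (leqnn _).
    (* The guess is the predecessor of the value, as [expand] asks for the value [z.+1]. *)
    apply: (@provable_step k) => c gl.
    have [c1 h1] := IH (fun m h => hm m (leqW h)) c gl.
    have [c2 h2] := hk c1 ((PP f, encl xs, n) :: gl).
    by exists c2; apply: reaches_trans h1; move: h2; rewrite /expand /= ?npairE.
  apply: (@provable_step 0) => c gl.
  have [c1 h1] := hP c gl.
  have [c2 h2] := eval_provable _ _ _ hf c1 ((PP f, encl xs, n) :: gl).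
  by exists c2; apply: reaches_trans h1; move: h2; rewrite /expand /= ?npairE.
case=> {gs xs ys} [xs|g gs xs y ys hg hgs].
  apply: (@provable_step 0) => c gl; exists c.
  rewrite /expand /= ?npairE; exact: reaches_refl.
apply: (@provable_step 0) => c gl.
have [c1 h1] := evals_provable _ _ _ hgs c gl.
have [c2 h2] := eval_provable _ _ _ hg c1 ((PL gs, encl xs, encl ys) :: gl).
by exists c2; apply: reaches_trans h1; move: h2; rewrite /expand /= ?npairE.
Qed.

(** * Recursiveness of the machine and the search for enumerated strings *)

Lemma recf_nhd k A : recf k A -> recf k (fun xs => nhd (A xs)).
Proof. by move=> hA; apply: recf_nfst; apply: recf_pred. Qed.

Lemma recf_ntl k A : recf k A -> recf k (fun xs => ntl (A xs)).
Proof. by move=> hA; apply: recf_nsnd; apply: recf_pred. Qed.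

Lemma recf_ncons k A B : recf k A -> recf k B ->
  recf k (fun xs => ncons (A xs) (B xs)).
Proof. by move=> hA hB; apply: recf_succ; apply: recf_npair. Qed.

Ltac recf_auto := repeat lazymatch goal with
  | |- recf _ (fun _ => ?c) => exact: recf_const
  | |- recf _ (fun xs => nth 0 xs _) => exact: recf_proj
  | |- recf _ (fun xs => (@?A xs).+1) => apply: recf_succ
  | |- recf _ (fun xs => (@?A xs).-1) => apply: recf_pred
  | |- recf _ (fun xs => @?A xs + @?B xs) => apply: recf_add
  | |- recf _ (fun xs => @?A xs * @?B xs) => apply: recf_mul
  | |- recf _ (fun xs => nfst (@?A xs)) => apply: recf_nfst
  | |- recf _ (fun xs => nsnd (@?A xs)) => apply: recf_nsnd
  | |- recf _ (fun xs => npair (@?A xs) (@?B xs)) => apply: recf_npair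
  | |- recf _ (fun xs => nhd (@?A xs)) => apply: recf_nhd
  | |- recf _ (fun xs => ntl (@?A xs)) => apply: recf_ntl
  | |- recf _ (fun xs => ncons (@?A xs) (@?B xs)) => apply: recf_ncons
  | |- recf _ (fun xs => if _ then _ else _) =>
      apply: recf_ifeq
  end.

Lemma recf_step k A : recf k A -> recf k (fun xs => step (A xs)).
Proof.
apply: recf_app1; rewrite /step /expand /goal.
recf_auto.
Qed.

(* [w] codes a string code, a number of steps, a value and a list of guesses. *)
Definition start e w :=
  npair (nsnd (nsnd (nsnd w)))
    (ncons (goal e (encl [:: e.+2; nfst w]) (nfst (nsnd (nsnd w)))) 0).

Definition unfinished e w := nsnd (iter (nfst (nsnd w)) step (start e w)).

Lemma recf_unfinished k A B : recf k A -> recf k B ->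
  recf k (fun xs => unfinished (A xs) (B xs)).
Proof.
apply: recf_app2; rewrite /unfinished /start /goal /=; apply: recf_nsnd.
apply: (recf_ext _ (recf_iteri (A := fun v => start (nth 0 v 0) (nth 0 v 1))
  (recf_step (recf_proj _ 1)) _ (recf_nfst (recf_nsnd (recf_proj _ 1))))) => [xs /=|].
  by elim: (nfst (nsnd (nth 0 xs 1))) => //= n ->.
by rewrite /start /goal /=; recf_auto.
Qed.

Lemma unfinished_sound e w : unfinished (enc e) w = 0 ->
  exists y, eval e [:: (enc e).+2; nfst w] y.
Proof.
set g := (PE e, encl [:: (enc e).+2; nfst w], nfst (nsnd (nsnd w))).
move=> /(run_sound (gl := [:: g])) [h _].
by exists (nfst (nsnd (nsnd w))); apply: h; exact: lists_encl.
Qed.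

Lemma unfinished_complete e c y : eval e [:: (enc e).+2; c] y ->
  exists w, unfinished (enc e) w = 0.
Proof.
move=> /eval_provable /(_ 0 [::])[c' [n hn]].
exists (npair c (npair n (npair y c'))).
rewrite /unfinished /start !npairE.
by move: hn; rewrite /state /= /encg => ->; rewrite npairE.
Qed.

(* One plus the first successful search below [t], or 0. *)
Definition found e t :=
  iteri t (fun m r => if r == 0 then if unfinished e m == 0 then m.+1 else 0 else r) 0.

Lemma recf_found k A B : recf k A -> recf k B ->
  recf k (fun xs => found (A xs) (B xs)).
Proof.
move=> hA; apply: (recf_app2 (f := found)) hA.
apply: (recf_iteri (G := fun v => if nth 0 v 1 == 0 then
  if unfinished (nth 0 v 2) (nth 0 v 0) == 0 then (nth 0 v 0).+1 else 0 else nth 0 v 1)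
  _ (recf_const _ 0) (recf_proj _ 1)).
by recf_auto; apply: recf_unfinished; exact: recf_proj.
Qed.

Lemma foundS e t : found e t.+1 = if found e t == 0 then
  if unfinished e t == 0 then t.+1 else 0 else found e t.
Proof. by []. Qed.

Lemma found_stable e t t' : t <= t' -> found e t != 0 -> found e t' = found e t.
Proof.
move=> /subnKC <-; elim: (t' - t) => [|d IH] ft; first by rewrite addn0.
by rewrite addnS foundS IH // (negbTE ft).
Qed.

Lemma found_sound e t : found e t != 0 -> unfinished e (found e t).-1 = 0.
Proof.
elim: t => // t IH; rewrite foundS; case: (eqVneq (found e t) 0) => [_|h _].
  by case: (eqVneq (unfinished e t) 0).
exact: IH.
Qed.

Lemma found_complete e w : unfinished e w = 0 -> found e w.+1 != 0.
Proof. by rewrite foundS => ->; case: (eqVneq (found e w) 0). Qed.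

(** * Codes of strings and the prefix relation *)

Lemma code_surj n : exists s, code s = n.
Proof.
elim/ltn_ind: n => -[|n] IH; first by exists [::].
have [s hs] := IH n./2 ltac:(lia); exists (odd n :: s).
by rewrite /= hs addn1 addSn addnC odd_double_half.
Qed.

(** The digits are 1 and 2 with the first bit least significant, so an appended bit becomes the
    leading digit. Hence extending [s] changes its code by a multiple of [2 ^ size s]. *)
Lemma code_rcons s b : code (rcons s b) = code s + 2 ^ size s * b.+1.
Proof.
elim: s => [|a s IH]; first by case: b.
by rewrite rcons_cons /= IH -!muln2 expnS; nia.
Qed.

Lemma code_bounds s : 2 ^ size s - 1 <= code s < 2 ^ (size s).+1 - 1.
Proof.
elim: s => // b s /andP[h1 h2]; rewrite /= -muln2.
have := expn_gt0 2 (size s); rewrite /= in h2 *.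
by move: h1 h2; rewrite !expnS; case: b => /=; lia.
Qed.

Lemma size_le_code s : size s <= code s.
Proof. by elim: s => //= b s; lia. Qed.

(** Codes of strings of length [r] lie between [2 ^ r - 1] and [2 ^ r.+1 - 2], so the length can be
    read off the code. *)
Definition pow2len a := 2 ^ floor_inv (fun r => 2 ^ r - 1) a.

Lemma pow2len_code s : pow2len (code s) = 2 ^ size s.
Proof.
rewrite /pow2len (@floor_inv_eq (fun r => 2 ^ r - 1) _ (size s)) // => [i|];
  last exact: code_bounds.
by have := expn_gt0 2 i; rewrite expnS; lia.
Qed.

(* [s] is a prefix of [t] when [code t - code s] is a multiple of [2 ^ size s]. *)
Definition prefixn a c :=
  iteri c.+1 (fun u r => if a + pow2len a * u == c then 1 else r) 0.

Lemma prefixnE a c : prefixn a c = `[< exists u, a + pow2len a * u = c >].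
Proof.
have p_gt0 : 0 < pow2len a by rewrite expn_gt0.
have H n : iteri n (fun u r => if a + pow2len a * u == c then 1 else r) 0 =
    `[< exists2 u, u < n & a + pow2len a * u = c >].
  elim: n => [|n IH] /=; first by rewrite asboolF => [|[]].
  rewrite IH; case: eqP => E; first by rewrite asboolT //; exists n.
  congr (nat_of_bool _); apply/asbool_equiv_eq; split=> -[u hu Eu].
    by exists u => //; exact: leqW.
  by exists u => //; move: hu; rewrite ltnS leq_eqVlt => /orP[/eqP u_n|//];
    rewrite u_n in Eu.
rewrite /prefixn H; congr (nat_of_bool _); apply/asbool_equiv_eq.
split=> [[u _ Eu]|[u Eu]]; exists u => //.
by rewrite ltnS -Eu; nia.
Qed.

Lemma prefixn_rcons s c :
  prefixn (code (rcons s false)) c + prefixn (code (rcons s true)) c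
    <= prefixn (code s) c.
Proof.
rewrite !prefixnE !pow2len_code !size_rcons !code_rcons.
have := expn_gt0 2 (size s); set p := 2 ^ size s => p_gt0.
case: asboolP => [[u Eu]|_]; case: asboolP => [[v Ev]|_] //=.
(* If both children were prefixes, the same multiple of [p] would have an odd and an even factor. *)
- have /eqP : p * (1 + 2 * u) = p * (2 + 2 * v).
    by move: Eu; rewrite -Ev expnS -/p; nia.
  by rewrite eqn_pmul2l //; lia.
- by rewrite asboolT //; exists (1 + 2 * u); move: Eu; rewrite expnS -/p; nia.
- by rewrite asboolT //; exists (2 + 2 * v); move: Ev; rewrite expnS -/p; nia.
Qed.

Lemma prefixn_le1 a c : prefixn a c <= 1.
Proof. by rewrite prefixnE leq_b1. Qed.

Lemma prefixn_refl c : prefixn c c = 1.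
Proof. by rewrite prefixnE asboolT //; exists 0; rewrite muln0 addn0. Qed.

Lemma prefixn_size s c : c < size s -> prefixn (code s) c = 0.
Proof.
move=> h; rewrite prefixnE asboolF // => -[u Eu].
by have := size_le_code s; lia.
Qed.

Lemma recf_prefixn k A B : recf k A -> recf k B ->
  recf k (fun xs => prefixn (A xs) (B xs)).
Proof.
have hp k' A' : recf k' A' -> recf k' (fun xs => pow2len (A' xs)).
  move=> hA; apply: recf_exp2; apply: recf_floor_inv hA.
  by apply: recf_sub; [apply: recf_exp2; exact: recf_proj | exact: recf_const].
move=> hA; apply: (recf_app2 (f := prefixn)) hA.
apply: (recf_iteri (G := fun v => if nth 0 v 2 + pow2len (nth 0 v 2) * nth 0 v 0
  == nth 0 v 3 then 1 else nth 0 v 1) _ (recf_const _ 0) (recf_succ (recf_proj _ 1))).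
by recf_auto; apply: hp; exact: recf_proj.
Qed.

(** * Strings charged by a requirement *)

(* [s] codes a prefix of the string that requirement [e] has found by stage [t]. *)
Definition marked s e t :=
  if found e t == 0 then 0 else prefixn s (nfst (found e t).-1).

Lemma marked_le1 s e t : marked s e t <= 1.
Proof. by rewrite /marked; case: ifP => // _; exact: prefixn_le1. Qed.

Lemma marked_mono s e t t' : t <= t' -> marked s e t <= marked s e t'.
Proof.
move=> le_t; rewrite /marked; case: (eqVneq (found e t) 0) => // h.
by rewrite (found_stable le_t h) (negbTE h).
Qed.

Lemma marked_rcons s e t :
  marked (code (rcons s false)) e t + marked (code (rcons s true)) e t
    <= marked (code s) e t.
Proof. by rewrite /marked; case: ifP => // _; exact: prefixn_rcons. Qed.

(** A search result never changes once found, so a requirement has at most one target over all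
    stages, and the code of the target bounds its length. *)
Lemma marked_size e : exists n, forall s t, n < size s -> marked (code s) e t = 0.
Proof.
case: (pselect (exists t, found e t != 0)) => [[t0 ft0]|nf].
  exists (nfst (found e t0).-1) => s t h; rewrite /marked.
  case: (eqVneq (found e t) 0) => // ft.
  rewrite (_ : found e t = found e t0) ?prefixn_size //.
  by case/orP: (leq_total t t0) => /found_stable-> //.
exists 0 => s t _; rewrite /marked; case: eqVneq => // ft.
by case: nf; exists t.
Qed.

Lemma marked_size_below N :
  exists n, forall e s t, e < N -> n < size s -> marked (code s) e t = 0.
Proof.
elim: N => [|N [n hn]]; first by exists 0.
have [m hm] := marked_size N; exists (n + m) => e s t.
rewrite ltnS leq_eqVlt => /orP[/eqP->|he] h; [apply: hm | apply: hn => //]; lia.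
Qed.

(** [e] is the code of a program enumerating [U] itself, fixed before anything is assumed about
    level [e.+2]; nonemptiness of that level makes the search succeed. *)
Lemma marked_hit U : unif_ce U -> exists e, (exists s, U e.+2 s) ->
  exists s t0, U e.+2 s /\ forall t, t0 <= t -> marked (code s) e t = 1.
Proof.
move=> [p hp]; exists (enc p) => -[s0 /hp[y /unfinished_complete[w /found_complete]]].
set f := found _ _ => f0; have [s hs] := code_surj (nfst f.-1).
exists s, w.+1; split=> [|t /found_stable E].
  by apply/hp; rewrite hs; apply: unfinished_sound; exact: found_sound.
by rewrite /marked E // -/f (negbTE f0) hs prefixn_refl.
Qed.

(** * Rational approximations by stages *)

Definition numer s t :=
  if s == 0 then 2 ^ t else iteri t (fun e r => 2 * r + marked s e t) 0.

Lemma recf_numer : recf 2 (fun v => numer (nth 0 v 0) (nth 0 v 1)).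
Proof.
rewrite /numer; apply: recf_if0;
  [exact: recf_proj | exact: recf_exp2 (recf_proj _ _) |].
apply: (recf_iteri
  (G := fun v => 2 * nth 0 v 1 + marked (nth 0 v 2) (nth 0 v 0) (nth 0 v 3))
  _ (recf_const _ 0) (recf_proj _ 1)); rewrite /marked.
recf_auto; do ?apply: recf_prefixn; recf_auto;
  by apply: recf_found; exact: recf_proj.
Qed.

Local Open Scope ring_scope.
Local Notation R := Rdefinitions.R.

(** Code 0 is the empty string, where a semi-measure must have the value 1 from the start. Elsewhere
    only the requirements below [t] act at stage [t]. *)
Definition approx a t : R :=
  if a == 0%N then 1 else \sum_(0 <= e < t) (marked a e t)%:R / 2 ^+ e.+1.

(** The iteration in [numer] is Horner's rule for the weighted sum over the denominator [2 ^ t]; the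
    induction varies the number of summands and keeps the stage fixed. *)
Lemma numer_approx a t : (numer a t)%:R / 2 ^+ t = approx a t.
Proof.
rewrite /numer /approx; case: ifP => _; first by rewrite natrX divff // expf_neq0.
suff H n : (iteri n (fun e r => 2 * r + marked a e t)%N 0%N)%:R / 2 ^+ n =
    \sum_(0 <= e < n) (marked a e t)%:R / 2 ^+ e.+1 :> R by exact: H.
elim: n => [|n IH]; first by rewrite big_geq // mul0r.
rewrite big_nat_recr //= -IH natrD natrM mulrDl exprS; congr (_ + _).
by rewrite invfM mulrACA divff ?mul1r.
Qed.

Lemma sum_geom (m n : nat) :
  \sum_(m <= e < m + n) 1 / 2 ^+ e.+1 = 2 ^- m - 2 ^- (m + n) :> R.
Proof.
elim: n => [|n IH]; first by rewrite addn0 big_geq // subrr.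
rewrite addnS big_nat_recr ?leq_addr //= IH exprS invfM; lra.
Qed.

Lemma approx_ge0 a t : 0 <= approx a t.
Proof.
rewrite /approx; case: ifP => // _; apply: sumr_ge0 => e _.
by rewrite divr_ge0 ?exprn_ge0.
Qed.

Lemma approx_mono a t t' : (t <= t')%N -> approx a t <= approx a t'.
Proof.
move=> le_t; rewrite /approx; case: ifP => // _.
rewrite (big_cat_nat (n := t) (p := t')) //=; apply: ler_wpDr.
  by apply: sumr_ge0 => e _; rewrite divr_ge0 ?exprn_ge0.
apply: ler_sum => e _; rewrite ler_wpM2r ?invr_ge0 ?exprn_ge0 // ler_nat.
exact: marked_mono.
Qed.

Lemma approx_tail a t N : a != 0%N ->
  (forall e t', (e < N)%N -> marked a e t' = 0%N) -> approx a t <= 2 ^- N.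
Proof.
(* Stage [t] may come before [N]; passing to stage [N + t] allows splitting the sum at [N]. *)
move=> /negbTE a0 indN; apply: (le_trans (approx_mono a (leq_addl N t))).
rewrite /approx a0 (big_cat_nat (n := N)) ?leq_addr //= big_nat_cond big1 ?add0r.
  apply: le_trans (_ : \sum_(N <= e < N + t) 1 / 2 ^+ e.+1 <= _).
    apply: ler_sum => e _.
    by rewrite ler_wpM2r ?invr_ge0 ?exprn_ge0 // lern1 marked_le1.
  by rewrite sum_geom gerBl invr_ge0 exprn_ge0.
by move=> e /andP[/andP[_ /indN ->] _]; rewrite mul0r.
Qed.

Lemma approx_le1 a t : approx a t <= 1.
Proof.
case: (eqVneq a 0%N) => [->//|a0].
by have := approx_tail t a0 (N := 0); rewrite expr0 invr1; exact.
Qed.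

Lemma approx_rcons s t :
  approx (code (rcons s false)) t + approx (code (rcons s true)) t
    <= approx (code s) t.
Proof.
have nz b : (code (rcons s b) == 0%N) = false.
  by apply/negbTE; rewrite code_rcons addn_eq0 muln_eq0 expn_eq0 andbF.
have key : \sum_(0 <= e < t) (marked (code (rcons s false)) e t)%:R / 2 ^+ e.+1
    + \sum_(0 <= e < t) (marked (code (rcons s true)) e t)%:R / 2 ^+ e.+1
    <= \sum_(0 <= e < t) (marked (code s) e t)%:R / 2 ^+ e.+1 :> R.
  rewrite -big_split; apply: ler_sum => e _ /=.
  by rewrite -mulrDl -natrD ler_wpM2r ?invr_ge0 ?exprn_ge0 // ler_nat marked_rcons.
rewrite {1 2}/approx !nz; apply: le_trans key _; rewrite /approx.
(* At the root the right side is 1 instead of the sum, and all the weights together stay below 1. *)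
case: ifP => // _; apply: le_trans (_ : \sum_(0 <= e < 0 + t) 1 / 2 ^+ e.+1 <= _).
  by apply: ler_sum => e _; rewrite ler_wpM2r ?invr_ge0 ?exprn_ge0 // lern1 marked_le1.
by rewrite sum_geom expr0 invr1 gerBl invr_ge0 exprn_ge0.
Qed.

Lemma approx_hit a e t : (e < t)%N -> marked a e t = 1%N -> 2 ^- e.+1 <= approx a t.
Proof.
move=> lt_et hit; rewrite /approx; case: ifP => _.
  by rewrite invf_le1 ?exprn_gt0 // exprn_ege1 // ler1n.
rewrite (big_cat_nat (n := e.+1)) //= big_nat_recr //= hit mul1r.
by rewrite addrAC lerDr addr_ge0 // sumr_ge0 // => i _; rewrite divr_ge0 ?exprn_ge0.
Qed.

(** * The limit semi-measure and its properties *)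

Definition rho s : R := sup (range (approx (code s))).

Lemma has_sup_approx a : has_sup (range (approx a)).
Proof.
split; first by exists (approx a 0), 0%N.
by exists 1 => _ [t _ <-]; exact: approx_le1.
Qed.

Lemma approx_le_rho s t : approx (code s) t <= rho s.
Proof. by apply: sup_upper_bound; [exact: has_sup_approx | exists t]. Qed.

Lemma rho_le s (x : R) : (forall t, approx (code s) t <= x) -> rho s <= x.
Proof.
move=> h; apply: ge_sup; first by exists (approx (code s) 0), 0%N.
by move=> _ [t _ <-].
Qed.

Lemma rho_adherent s (eps : R) : 0 < eps -> exists t, rho s - eps < approx (code s) t.
Proof.
by move=> /sup_adherent /(_ (has_sup_approx (code s)))[_ [t _ <-]]; exists t.
Qed.

Lemma rho_semimeasure : semimeasure rho.
Proof.
split=> [s|]; [|split=> [|s]].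
- rewrite (le_trans (approx_ge0 (code s) 0)) ?approx_le_rho //.
  by apply: rho_le => t; exact: approx_le1.
- apply/eqP; rewrite eq_le rho_le => [|t]; last exact: approx_le1.
  exact: (approx_le_rho [::] 0).
(* The two suprema are bounded one after the other, at stages [t] and [t']; by monotonicity both are
   compared at the common stage [t + t']. *)
rewrite -lerBrDr; apply: rho_le => t; rewrite lerBrDr -lerBrDl; apply: rho_le => t'.
rewrite lerBrDl; apply: le_trans (approx_le_rho s (t + t')).
apply: le_trans (approx_rcons s (t + t')).
by rewrite lerD // approx_mono // ?leq_addr ?leq_addl.
Qed.

Lemma recf_computable_sn (f : nat -> nat -> nat) :
  recf 2 (fun v => f (nth 0%N v 0) (nth 0%N v 1)) ->
  computable_sn (fun s t => f (code s) t).
Proof. by move=> [e he]; exists e => s n; exact: (he [:: code s; n]). Qed.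

Lemma rho_left_ce : left_ce rho.
Proof.
(* The denominator [2 ^ t] is given by its predecessor, since the coding divides by [c.+1]. *)
exists (fun s => numer (code s)), (fun _ _ => 0%N), (fun _ t => (2 ^ t).-1).
(* The cast to [R] in [left_ce] makes its quotient Stdlib's. *)
have qE s t : Rdefinitions.Rdiv (Rdefinitions.Rminus (numer (code s) t)%:R 0%:R)
    ((2 ^ t).-1.+1)%:R = approx (code s) t.
  by rewrite RdivE RminusE subr0 prednK ?expn_gt0 // natrX numer_approx.
split.
- exact: recf_computable_sn recf_numer.
- exact: (recf_computable_sn (f := fun _ _ => 0%N) (recf_const _ _)).
- apply: (recf_computable_sn (f := fun _ t => (2 ^ t).-1)).
  by apply: recf_pred; apply: recf_exp2; exact: recf_proj.
rewrite /= => s; split=> [t|]; first by rewrite !qE approx_mono.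
split=> [t|eps eps_gt0]; first by rewrite qE approx_le_rho.
by have [t ht] := rho_adherent s eps_gt0; exists t; rewrite qE.
Qed.

Lemma rho_non_atomic : non_atomic rho.
Proof.
move=> X eps eps_gt0.
have [N hN] : exists N, 2 ^- N < eps.
  exists (Num.bound eps^-1); rewrite -[ltRHS]invrK ltf_pV2 ?posrE ?exprn_gt0 ?invr_gt0 //.
  exact: upper_nthrootP.
(* On prefixes longer than [n] the first [N] requirements contribute nothing, and the others have
   total weight at most [2^-N]. *)
have [n hn] := marked_size_below N; exists n.+1; apply: le_lt_trans hN.
apply: rho_le => t; apply: approx_tail => [|e t' he].
  by rewrite -lt0n (leq_trans _ (size_le_code _)) // size_mkseq.
by apply: hn => //; rewrite size_mkseq.
Qed.

Lemma rho_MLR X : MLR rho X.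
Proof.
move=> U ceU small /= inU; have [e he] := marked_hit ceU.
(* That [X] is covered matters only here: it makes level [e.+2] nonempty. *)
have [s0 Us0 _] := inU e.+2.
have [|s [t0 [Us hit]]] := he; first by exists s0.
have : ((rho s)%:E <= (2 ^- e.+2 : R)%:E)%E.
  apply: le_trans (small e.+2); rewrite /rho_set.
  by apply: esum_ge; exists [set s]%classic; rewrite ?fsbig_set1 //; split=> // _ ->.
rewrite lee_fin leNgt => /negP; apply.
(* This stage is past [t0], so [s] is marked, and past [e], so the weight of requirement [e] is
   counted. *)
apply: lt_le_trans (approx_le_rho s (t0 + e.+1)).
apply: lt_le_trans (approx_hit _ (hit _ (leq_addr _ _))); last by rewrite leq_addl.
by rewrite ltf_pV2 ?posrE ?exprn_gt0 // ltr_eXn2l // ltr1n.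
Qed.

Theorem theorem5p6 :
  exists rho : seq bool -> Rdefinitions.R,
    [/\ semimeasure rho, left_ce rho, non_atomic rho & forall X, MLR rho X].
Proof.
exists rho; split.
- exact: rho_semimeasure.
- exact: rho_left_ce.
- exact: rho_non_atomic.
- exact: rho_MLR.
Qed.
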